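(* Let $\mathcal F$ be a class of NE approximators, or a class of CE approximators, or a class of CCE approximators, let $\mathcal D$ be a probability distribution on the payoff set $\mathcal U$, let $m\ge 1$ and $\delta\in(0,1)$. Then, with probability at least $1-\delta$ over the draw of a training set $S$ consisting of $m$ payoffs drawn i.i.d. from $\mathcal D$, the following holds for all $f\in\mathcal F$ simultaneously: $$\mathbb E_{u\sim\mathcal D}[\mathcal E(f(u),u)]-\frac1m\sum_{u\in S}\mathcal E(f(u),u)\ \le\ 2\cdot\inf_{r>0}\Big\{\sqrt{\frac{2\ln\mathcal N_\infty(\mathcal F,r)}{m}}+Lr\Big\}+4\sqrt{\frac{2\ln(4/\delta)}{m}},$$ where $L=2n$ for NE approximators and $L=2$ for CE and CCE approximators.
   Context: Fix a number of players $n\ge2$ and finite action sets $\mathcal A_i=\{1,\dots,m_i\}$, $i\in[n]$; $\mathcal A=\prod_{i}\mathcal A_i$. A payoff is $u=(u_i)_{i\in[n]}$ with $u_i:\mathcal A\to[0,1]$; $\mathcal U$ is the set of all payoffs. A joint strategy is $\pi\in\Delta\mathcal A$; a product strategy is $\sigma=(\sigma_i)_{i\in[n]}$, $\sigma_i\in\Delta\mathcal A_i$, identified with the corresponding product distribution. $u_i(\pi)=\sum_a\pi(a)u_i(a)$ and $u_i(a_i',\pi_{-i})=\sum_{a}\pi(a)u_i(a_i',a_{-i})$. Exploitability: $\mathcal E_i(\pi,u)=\max_{a_i'\in\mathcal A_i}u_i(a_i',\pi_{-i})-u_i(\pi)$ and $\mathcal E_i^{\mathrm{CE}}(\pi,u)=\max_{\phi_i:\mathcal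 A_i\to\mathcal A_i}\sum_a\pi(a)u_i(\phi_i(a_i),a_{-i})-u_i(\pi)$. The equilibrium approximation is $\mathcal E(\pi,u)=\max_i\mathcal E_i(\pi,u)$ in the NE and CCE cases, and $\mathcal E(\pi,u)=\max_i\mathcal E^{\mathrm{CE}}_i(\pi,u)$ in the CE case. An NE approximator is a map $f:\mathcal U\to\prod_i\Delta\mathcal A_i$; a CE (resp. CCE) approximator is a map $f:\mathcal U\to\Delta\mathcal A$ (with no requirement that outputs be equilibria). Approximators are tacitly measurable. Distances: $\|\sigma-\sigma'\|=\max_i\sum_{a_i}|\sigma_i(a_i)-\sigma_i'(a_i)|$ for product strategies, $\|\pi-\pi'\|=\sum_a|\pi(a)-\pi'(a)|$ for joint strategies; $\ell_\infty(f,g)=\sup_{u\in\mathcal U}\|f(u)-g(u)\|$. A class $\mathcal F_r$ of approximators of the same type (not required to be contained in $\mathcal F$) $r$-covers $\mathcal F$ if for every $f\in\mathcal F$ there is $f_r\in\mathcal F_r$ with $\ell_\infty(f,f_r)\le r$. $\mathcal N_\infty(\mathcal F,r)$ is the smallest cardinality of a class that $r$-covers $\mathcal F$ ($+\infty$ if no finite one exists). *)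

(* Defs.v *)
From HB Require Import structures.
From mathcomp Require Import all_boot all_order all_algebra.
From mathcomp Require Import all_classical all_reals all_analysis.
Set Implicit Arguments.
Unset Strict Implicit.
Unset Printing Implicit Defensive.
Import Order.TTheory GRing.Theory Num.Theory.
Local Open Scope classical_set_scope.
Local Open Scope ring_scope.

(* Player i has the action set 'I_(k i), of cardinality k i. *)
Definition profile (n : nat) (k : 'I_n -> nat) : finType :=
  {dffun forall i : 'I_n, 'I_(k i)}.

(* The profile (b, a_{-i}). *)
Definition deviate (n : nat) (k : 'I_n -> nat) (a : profile k) (i : 'I_n)
    (b : 'I_(k i)) : profile k :=
  finfun (dfwith a i b).

Record simplex (R : realType) (T : finType) := Simplex {
  mass :> T -> R ;
  mass_ge0 : forall x, 0 <= mass x ;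
  mass_sum1 : \sum_x mass x = 1 }.

Record payoff (R : realType) (n : nat) (k : 'I_n -> nat) := Payoff {
  pay :> 'I_n -> profile k -> R ;
  pay_itv : forall i a, 0 <= pay i a <= 1 }.

Section payoff_measurable.
Context {R : realType} {n : nat} {k : 'I_n -> nat}.
Local Notation U := (payoff R k).

Lemma payoff0_subproof (i : 'I_n) (a : profile k) : 0 <= (0 : R) <= 1.
Proof. by rewrite lexx ler01. Qed.

HB.instance Definition _ := gen_eqMixin U.
HB.instance Definition _ := gen_choiceMixin U.
HB.instance Definition _ :=
  isPointed.Build U (@Payoff R n k (fun _ _ => 0) payoff0_subproof).

(* The Borel sigma-algebra of U, seen as a subset of a finite power of R: it is
   generated by the coordinate maps u |-> u_i(a). *)
Definition payoff_measurable : set (set U) :=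
  <<s [set B | exists i a, exists2 A : set R,
         measurable A & B = [set u : U | A (u i a)]] >>.

Lemma payoff_measurable0 : payoff_measurable set0.
Proof. exact: sigma_algebra0. Qed.

Lemma payoff_measurableC (A : set U) :
  payoff_measurable A -> payoff_measurable (~` A).
Proof. by rewrite -setTD; exact: sigma_algebraCD. Qed.

Lemma payoff_measurable_bigcup (A : (set U)^nat) :
  (forall j, payoff_measurable (A j)) -> payoff_measurable (\bigcup_j A j).
Proof. exact: sigma_algebra_bigcup. Qed.

HB.instance Definition _ := @isMeasurable.Build default_measure_display U
  payoff_measurable payoff_measurable0 payoff_measurableC
  payoff_measurable_bigcup.

End payoff_measurable.

Section game.
Context {R : realType} {n : nat} {k : 'I_n -> nat}.
Local Notation U := (payoff R k).
Local Notation joint := (simplex R (profile k)).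

(* In the suprema of ranges below, the range is finite and nonempty (as soon as
   there is a player and every player has an action), so these are maxima. *)
Definition utility (p : profile k -> R) (u : U) (i : 'I_n) : R :=
  \sum_a p a * u i a.

Definition exploit (p : profile k -> R) (u : U) (i : 'I_n) : R :=
  sup (range (fun b : 'I_(k i) => \sum_a p a * u i (deviate a b)))
  - utility p u i.

Definition exploitCE (p : profile k -> R) (u : U) (i : 'I_n) : R :=
  sup (range (fun phi : {ffun 'I_(k i) -> 'I_(k i)} =>
         \sum_a p a * u i (deviate a (phi (a i)))))
  - utility p u i.

End game.

Inductive concept := NE | CE | CCE.

Section approximators.
Context (R : realType) (n : nat) (k : 'I_n -> nat).
Local Notation U := (payoff R k).

Definition strategy (c : concept) : Type :=
  match c with
  | NE => forall i : 'I_n, simplex R 'I_(k i)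
  | CE | CCE => simplex R (profile k)
  end.

(* A product strategy is identified with its product distribution. *)
Definition joint_mass (c : concept) : strategy c -> profile k -> R :=
  match c return strategy c -> profile k -> R with
  | NE => fun s a => \prod_(i < n) s i (a i)
  | CE | CCE => fun p a => p a
  end.

Definition equilibrium_gap (c : concept) (s : strategy c) (u : U) : R :=
  match c with
  | NE | CCE => sup (range (exploit (joint_mass s) u))
  | CE => sup (range (exploitCE (joint_mass s) u))
  end.

Definition strategy_dist (c : concept) : strategy c -> strategy c -> R :=
  match c return strategy c -> strategy c -> R with
  | NE => fun s t => sup (range (fun i : 'I_n => \sum_b `|s i b - t i b|))
  | CE | CCE => fun p q => \sum_a `|p a - q a|
  end.

(* Measurability for the Borel sigma-algebra of the (product of) simplices,
   which is generated by the coordinates. *)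
Definition measurable_approx (c : concept) : (U -> strategy c) -> Prop :=
  match c return (U -> strategy c) -> Prop with
  | NE => fun f => forall (i : 'I_n) (b : 'I_(k i)),
      measurable_fun [set: U] (fun u => f u i b)
  | CE | CCE => fun f => forall a : profile k,
      measurable_fun [set: U] (fun u => f u a)
  end.

Record approximator (c : concept) := Approximator {
  approx_map :> U -> strategy c ;
  approx_measurable : measurable_approx approx_map }.

Definition linf_dist (c : concept) (f g : approximator c) : R :=
  sup (range (fun u : U => strategy_dist (f u) (g u))).

Definition covers (c : concept) (r : R) (G F : set (approximator c)) : Prop :=
  forall f, F f -> exists2 g, G g & linf_dist f g <= r.

(* Since ereal_inf set0 = +oo, this is +oo when there is no finite cover. *)
Definition covering_number (c : concept) (F : set (approximator c)) (r : R) :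
    \bar R :=
  ereal_inf [set (N%:R)%:E | N in
    [set N : nat | exists2 G, (G #= `I_N)%card & covers r G F]].

Definition lip_const (c : concept) : R :=
  match c with NE => 2 * n%:R | CE | CCE => 2 end.

End approximators.

(* The X i are independent, with common law D. *)
Definition iid (R : realType) (d d' : measure_display) (Omega : measurableType d)
    (T : measurableType d') (P : probability Omega R) (D : probability T R)
    (m : nat) (X : 'I_m -> {mfun Omega >-> T}) : Prop :=
  (forall i A, measurable A -> P (X i @^-1` A) = D A) /\
  (forall (J : {set 'I_m}) (A : 'I_m -> set T),
     (forall i, measurable (A i)) ->
     P (\bigcap_(i in [set` J]) (X i @^-1` A i))
     = (\prod_(i in J) P (X i @^-1` A i))%E).

(* Main.v *)
Require Import Defs.
From HB Require Import structures.
From mathcomp Require Import all_boot all_order all_algebra.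
From mathcomp Require Import all_classical all_reals all_analysis.
From mathcomp Require Import measurable_realfun ring lra.
Set Implicit Arguments.
Unset Strict Implicit.
Unset Printing Implicit Defensive.
Import Order.TTheory GRing.Theory Num.Theory.
Local Open Scope classical_set_scope.
Local Open Scope ring_scope.

(* The equilibrium gap of a strategy is Lipschitz with constant L, so replacing
   an approximator by a member of an r-cover at distance at most r changes the
   expected and the empirical gap by at most L r each.  For the N members of a
   finite cover, Hoeffding's inequality for functions with values in [-1, 1] and
   a union bound give, outside an event of probability at most delta, a
   deviation of at most 2 sqrt(2 ln N / m) + 2 sqrt(2 ln(1 / delta) / m).  The
   infimum over r need not be attained: one fixes an r at which the bracket
   exceeds it by less than sqrt(2 ln(4 / delta) / m), and the constant 4 in the
   last term of the bound absorbs this loss. *)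

(** * Expectations of products over an i.i.d. sample *)

Import HBNNSimple.

(** The identity assumed for indicators extends to nonnegative simple functions by linearity and to
    [phi] by monotone convergence. In the application [W] is the product of the other factors, so
    that factors can be generalized one at a time. *)
Lemma ge0_integral_mul_comp (R : realType) (d d' : measure_display)
    (Omega : measurableType d) (T : measurableType d')
    (P : {measure set Omega -> \bar R}) (D : {measure set T -> \bar R})
    (X : Omega -> T) (W : Omega -> R) (c : \bar R) :
  measurable_fun [set: Omega] X -> measurable_fun [set: Omega] W ->
  (forall w, 0 <= W w) -> (0 <= c)%E -> c \is a fin_num ->
  (forall A, measurable A ->
     \int[P]_w (W w * \1_A (X w))%:E = c * D A)%E ->
  forall phi : T -> R, measurable_fun [set: T] phi -> (forall x, 0 <= phi x) ->
  (\int[P]_w (W w * phi (X w))%:E = c * \int[D]_x (phi x)%:E)%E.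
Proof.
move=> mX mW W0 c0 cfin H phi mphi phi0.
have mphiE : measurable_fun [set: T] (fun x => (phi x)%:E).
  exact/measurable_EFinP.
pose f_ := nnsfun_approx measurableT mphiE.
have fcvg x : ((f_ n x)%:E @[n --> \oo] --> (phi x)%:E)%E.
  by apply: cvg_nnsfun_approx => // y _; rewrite lee_fin.
have fnd x : {homo f_ ^~ x : k l / (k <= l)%N >-> k <= l}.
  by move=> k l kl; exact/lefP/nd_nnsfun_approx.
have mfX n : measurable_fun [set: Omega] (f_ n \o X).
  exact: measurableT_comp.
have mind (A : set T) : measurable A ->
    measurable_fun [set: Omega] (fun w => (\1_A (X w) : R)).
  by move=> mA; apply: (measurableT_comp (f := (\1_A : T -> R)) _ mX).
transitivity (limn (fun n => \int[P]_w (W w * f_ n (X w))%:E))%E.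
  rewrite -monotone_convergence//.
  - apply: eq_integral => w _; apply/esym/cvg_lim => //.
    by under eq_fun do rewrite EFinM; rewrite EFinM; exact: cvgeZl.
  - by move=> n; apply/measurable_EFinP/measurable_funM => //; exact: mfX.
  - by move=> n w _; rewrite lee_fin mulr_ge0.
  - by move=> w _ k l kl; rewrite lee_fin ler_wpM2l// fnd.
transitivity (limn (fun n => \int[D]_x (c * (f_ n x)%:E)))%E; last first.
  rewrite -ge0_integralZl//; last by move=> x _; rewrite lee_fin.
  rewrite -monotone_convergence//.
  - apply: eq_integral => x _; apply/cvg_lim => //.
    exact: cvgeZl.
  - by move=> n; apply: measurable_funeM; exact/measurable_EFinP.
  - by move=> n x _; rewrite mule_ge0// lee_fin.
  - by move=> x _ k l kl; rewrite lee_wpmul2l// lee_fin fnd.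
congr (limn _); apply/funext => n.
rewrite ge0_integralZl//; last by move=> x _; rewrite lee_fin.

have fE w : (f_ n w)%:E = (\sum_(k \in range (f_ n))
     (k * \1_(f_ n @^-1` [set k]) w)%:E)%E.
  by rewrite fimfunE fsumEFin.
(* This covers negative [y] too: the level set of the nonnegative [f_ n] is then empty. *)
have pos y w : (0 <= y%:E * (\1_(f_ n @^-1` [set y]) w)%:E)%E.
  exact: nnfun_muleindic_ge0.
transitivity (\sum_(k \in range (f_ n))
    (k%:E * (c * D (f_ n @^-1` [set k]))))%E.
  transitivity (\int[P]_w \sum_(k \in range (f_ n))
      ((W w)%:E * (k * \1_(f_ n @^-1` [set k]) (X w))%:E))%E.
    apply: eq_integral => w _; rewrite EFinM fE ge0_mule_fsumr// => y.
    by rewrite EFinM.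
  rewrite ge0_integral_fsum//; last 2 first.
  - move=> y; apply/measurable_EFinP/measurable_funM => //.
    by apply: measurable_funM => //; exact: mind.
  - by move=> y x _; rewrite mule_ge0 ?lee_fin// -lee_fin EFinM.
  apply: eq_fsbigr => r /[!inE] -[x _ xr].
  have r0 : 0 <= r by rewrite -xr.
  rewrite -H// -ge0_integralZl_EFin//.
  - by apply: eq_integral => w _; rewrite -!EFinM mulrCA.
  - by move=> w _; rewrite lee_fin mulr_ge0.
  - by apply/measurable_EFinP/measurable_funM => //; exact: mind.
under eq_integral do rewrite fE.
rewrite ge0_integral_fsum//; last 2 first.
- by move=> y; apply/measurable_EFinP/measurable_funM.
- by move=> y x _; rewrite EFinM.
rewrite ge0_mule_fsumr => [|y]; last first.
  by apply: integral_ge0 => x _; rewrite EFinM.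
apply: eq_fsbigr => r _.
by rewrite integralZl_indic_nnsfun// integral_indic// setIT muleCA.
exact/measurable_EFinP.
Qed.

(** Turns independence, which [iid] states for events, into the factorization of expectations that
    an exponential moment of the empirical mean requires. *)
Lemma iid_integral_prod (R : realType) (d d' : measure_display)
    (Omega : measurableType d) (T : measurableType d')
    (P : probability Omega R) (D : probability T R) (m : nat)
    (X : 'I_m -> {mfun Omega >-> T}) :
  iid P D X ->
  forall phi : 'I_m -> T -> R,
  (forall i, measurable_fun [set: T] (phi i)) ->
  (forall i x, 0 <= phi i x) ->
  (forall i, (\int[D]_x (phi i x)%:E)%E \is a fin_num) ->
  (\int[P]_w (\prod_i phi i (X i w))%:E = \prod_i \int[D]_x (phi i x)%:E)%E.
Proof.
move=> [XD Xindep].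
(* Induction on the number of factors allowed not to be indicators. *)
suff H l : (l <= m)%N -> forall phi : 'I_m -> T -> R,
    (forall i, measurable_fun [set: T] (phi i)) ->
    (forall i x, 0 <= phi i x) ->
    (forall i, (\int[D]_x (phi i x)%:E)%E \is a fin_num) ->
    (forall i : 'I_m, (l <= i)%N ->
       exists2 A, measurable A & phi i = \1_A) ->
    (\int[P]_w (\prod_i phi i (X i w))%:E = \prod_i \int[D]_x (phi i x)%:E)%E.
  move=> phi mphi phi0 phifin; apply: (H m) => // i.
  by rewrite leqNgt ltn_ord.
elim: l => [_|l IH lm] phi mphi phi0 phifin ind.
  (* When all factors are indicators, their product is the indicator of an intersection of
     preimages, and independence applies with [J] the full index set. *)
  have /choice[A HA] : forall i, exists A, measurable A /\ phi i = \1_A.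
    by move=> i; have [//|A] := ind i; exists A.
  transitivity (\int[P]_w (\1_(\bigcap_(i in [set` [set: 'I_m]%SET])
      (X i @^-1` A i)) w)%:E)%E.
    apply: eq_integral => w _; congr (_%:E).
    rewrite indicE; case: (boolP (w \in _)) => [|].
      rewrite inE => wA; rewrite big1// => i _.
      rewrite (HA i).2 indicE mem_set//; apply: wA => //=.
      by rewrite inE.
    move=> /negP wA; have : exists i, ~ A i (X i w).
      apply/not_existsP => h; apply: wA; rewrite inE => i _ /=.
      by have /contrapT := h i.
    move=> [i Ai]; rewrite (bigD1 i)//= (HA i).2 indicE memNset ?mul0r//.
  have mI : measurable (\bigcap_(i in [set` [set: 'I_m]%SET]) (X i @^-1` A i)).
    apply: fin_bigcap_measurable => // j _.
    by rewrite -[X in measurable X]setTI; apply: measurable_funP => //;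
      exact: (HA j).1.
  transitivity (P (\bigcap_(i in [set` [set: 'I_m]%SET]) (X i @^-1` A i))).
    by rewrite integral_indic// setIT.
  rewrite Xindep; last by move=> i; exact: (HA i).1.
  rewrite big_mkcond/=; apply: eq_bigr => i _.
  rewrite inE XD; last exact: (HA i).1.
  by rewrite (HA i).2 integral_indic ?setIT//; exact: (HA i).1.
pose i := Ordinal lm.
rewrite (bigD1 i)//= muleC.
transitivity (\int[P]_w ((\prod_(j | j != i) phi j (X j w))
    * phi i (X i w))%:E)%E.
  by apply: eq_integral => w _; rewrite (bigD1 i)//= mulrC.
pose W w := \prod_(j | j != i) phi j (X j w).
have mW : measurable_fun [set: Omega] W.
  rewrite (_ : W =
      fun w => \prod_j (if j != i then phi j (X j w) else 1)); last first.
    by apply/funext => w; exact: big_mkcond.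
  apply: measurable_prod => j _; case: (j != i) => //.
  exact: measurableT_comp.
apply: (ge0_integral_mul_comp (D := D) (X := X i) (W := W)) => //.
- by move=> w; apply: prodr_ge0.
- by apply: prode_ge0 => j _; apply: integral_ge0 => x _; rewrite lee_fin.
- by apply: prode_fin_num.
move=> A mA.
have mlt := ltnW lm.
(* With an indicator put back at index [l], the family falls under the induction hypothesis, which
   yields the identity to be checked on [A]. *)
pose psi j := if j == i then \1_A else phi j.
have psii : psi i = \1_A by rewrite /psi eqxx.
have psij j : j != i -> psi j = phi j by rewrite /psi => /negbTE ->.
have -> : (\prod_(j | j != i) \int[D]_x (phi j x)%:E * D A =
    \prod_j \int[D]_x (psi j x)%:E)%E.
  rewrite [RHS](bigD1 i)//= psii integral_indic// setIT muleC; congr (_ * _)%E.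
  by apply: eq_bigr => j ji; rewrite psij.
rewrite -IH//.
- apply: eq_integral => w _; rewrite (bigD1 i)//= psii mulrC; congr (_ * _)%:E.
  by apply: eq_bigr => j ji; rewrite psij.
- by move=> j; have [->|ji] := eqVneq j i; rewrite ?psii ?psij.
- by move=> j x; have [->|ji] := eqVneq j i; rewrite ?psii ?psij.
- move=> j; have [->|ji] := eqVneq j i; rewrite ?psii ?psij//.
  by rewrite integral_indic// setIT fin_num_measure.
- move=> j lj; have [->|ji] := eqVneq j i; first by exists A.
  by rewrite psij//; apply: ind; rewrite ltn_neqAle lj andbT eq_sym.
Qed.

(** * Exponential moments and Hoeffding's inequality *)

(** Twice the inequality [sinh x <= x cosh x]. The difference [K] vanishes at 0 and its derivative
    [2 y sinh y] is nonnegative for [y >= 0]. *)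
Lemma sinh_le_mul_cosh (R : realType) (x : R) :
  0 <= x -> expR x - expR (- x) <= x * (expR x + expR (- x)).
Proof.
move=> x0; rewrite -subr_ge0.
pose K (y : R) := y * (expR y + expR (- y)) - (expR y - expR (- y)).
pose K' (y : R) := y * (expR y - expR (- y)).
have dK y : is_derive y (1 : R) K (K' y).
  rewrite /K; apply: is_derive_eq.
  by rewrite /K' /GRing.scale/=; ring.
have K0 : K 0 = 0 by rewrite /K oppr0 mul0r subrr subr0.
rewrite -[leLHS]K0 -/(K x).
have [y yx ->] : exists2 y, y \in `[0, x] & K x = K' y * x.
  have [|y yx e] := @MVT_segment _ K K' 0 x x0 (fun y _ => dK y).
    apply: derivable_within_continuous => y _; exact: ex_derive.
  by exists y => //; rewrite -[K x]subr0 -[in LHS]K0 e subr0.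
rewrite K0 mulr_ge0// mulr_ge0//.
  by move: yx; rewrite in_itv/= => /andP[].
by rewrite subr_ge0 ler_expR ge0_cp//; move: yx; rewrite in_itv/= => /andP[].
Qed.

(** By parity [x >= 0]. There [G], which is [2 exp (- y^2 / 2) cosh y], does not exceed its value 2
    at 0, because its derivative has the sign of [sinh y - y cosh y]. *)
Lemma cosh_le_expR_sqr (R : realType) (x : R) :
  (expR x + expR (- x)) / 2 <= expR (x ^+ 2 / 2).
Proof.
wlog x0 : x / 0 <= x.
  move=> H; have [/H//|x0] := leP 0 x.
  by have := H (- x); rewrite opprK sqrrN addrC; apply; rewrite oppr_ge0 ltW.
pose G (y : R) := expR (- (y ^+ 2 / 2)) * (expR y + expR (- y)).
pose G' (y : R) := expR (- (y ^+ 2 / 2)) *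
  ((expR y - expR (- y)) - y * (expR y + expR (- y))).
have dG y : is_derive y (1 : R) G (G' y).
  rewrite /G; apply: is_derive_eq.
  by rewrite /G' /GRing.scale/=; field.
have G0 : G 0 = 2 by rewrite /G expr0n/= mul0r oppr0 expR0 mul1r.
have : G x - G 0 <= 0.
  have [|y yx ->] := @MVT_segment _ G G' 0 x x0 (fun y _ => dG y).
    apply: derivable_within_continuous => y _; exact: ex_derive.
  rewrite subr0 mulr_le0_ge0// /G' pmulr_rle0 ?expR_gt0// subr_le0.
  by apply: sinh_le_mul_cosh; move: yx; rewrite in_itv/= => /andP[].
rewrite G0 subr_le0 /G expRN mulrC ler_pdivrMr ?expR_gt0//.
by rewrite ler_pdivrMr// mulrC.
Qed.

(** Convexity of the exponential: [y] is the combination of 2 and -2 with weights [(2 + y) / 4] and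
    [(2 - y) / 4]. The bound 2 is the one available for a variable in [-1, 1] minus its mean. *)
Lemma expR_le_chord (R : realType) (s y : R) : `|y| <= 2 ->
  expR (s * y) <= (expR (2 * s) + expR (- (2 * s))) / 2
                  + y / 4 * (expR (2 * s) - expR (- (2 * s))).
Proof.
move=> /ler_normlP[yl yr].
have t0 : 0 <= (2 + y) / 4 by lra.
have t1 : (2 + y) / 4 <= 1 by lra.
pose t := (2 + y) / 4.
have H : expR (t * (2 * s) + (1 - t) * - (2 * s)) <=
    t * expR (2 * s) + (1 - t) * expR (- (2 * s)).
  by have := convex_expR (Itv01 t0 t1) (2 * s) (- (2 * s)); rewrite !convRE.
have <- : t * (2 * s) + (1 - t) * - (2 * s) = s * y by rewrite /t; field.
by apply: (le_trans H); rewrite le_eqVlt /t; apply/orP; left; apply/eqP; field.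
Qed.

Lemma bounded_integrable (R : realType) (d : measure_display)
    (T : measurableType d) (D : probability T R) (h : T -> R) (M : R) :
  measurable_fun [set: T] h -> (forall x, `|h x| <= M) ->
  D.-integrable [set: T] (EFin \o h).
Proof.
move=> mh hM; apply: measurable_bounded_integrable => //.
  exact: (le_lt_trans (probability_le1 D measurableT) (ltry 1)).
exists M; split; first exact: num_real.
by move=> N MN x _ /=; exact: le_trans (hM x) (ltW MN).
Qed.

(** The chord bound is affine in the centered variable, so integration leaves only its constant term
    [cosh (2 s)]. The exponent is four times the [s^2 / 2] of Hoeffding's lemma; the constants of
    the final bound are those that it produces. *)
Lemma mgf_le (R : realType) (d : measure_display) (T : measurableType d)
    (D : probability T R) (h : T -> R) (s : R) :
  measurable_fun [set: T] h -> (forall x, `|h x| <= 1) ->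
  (\int[D]_x (expR (s * (fine 'E_D[h] - h x)))%:E <= (expR (2 * s ^+ 2))%:E)%E.
Proof.
move=> mh h1; set mu := fine _.
have ih := bounded_integrable D mh h1.
have Efin : ('E_D[h] \is a fin_num)%E.
  by rewrite unlock; exact: integrable_fin_num.
have muE : 'E_D[h]%E = mu%:E by rewrite fineK.
have mu1 : `|mu| <= 1.
  rewrite -lee_fin -[X in (X <= _)%E]/(`|mu%:E|%E) -muE unlock.
  apply: (le_trans (le_abse_integral _ _ _)) => //.
    by case/integrableP : ih.
  have -> : 1%:E = (\int[D]_x 1%:E)%E.
    by rewrite -[LHS](expectation_cst D) unlock.
  apply: ge0_le_integral => //.
  - by apply: measurableT_comp => //; case/integrableP : ih.
  - by move=> x _ /=; rewrite lee_fin.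
(* [a] is the height of the chord at 0 and [b] its slope. *)
pose a := (expR (2 * s) + expR (- (2 * s))) / 2.
pose b := (expR (2 * s) - expR (- (2 * s))) / 4.
have chord x : expR (s * (mu - h x)) <= (a + b * mu) - b * h x.
  have y2 : `|mu - h x| <= 2.
    by apply: (le_trans (ler_normB _ _)); rewrite -[2]/(1 + 1) lerD.
  apply: (le_trans (expR_le_chord s y2)).
  by rewrite le_eqVlt; apply/orP; left; apply/eqP; rewrite /a /b; field.
have mexp : measurable_fun [set: T] (fun x => expR (s * (mu - h x))).
  apply: measurableT_comp => //; apply: measurable_funM => //.
  exact: measurable_funB.
apply: (@le_trans _ _ (\int[D]_x ((a + b * mu) - b * h x)%:E)%E).
  apply: ge0_le_integral => //.
  - exact/measurable_EFinP.
  - apply/measurable_EFinP/measurable_funB => //; exact: measurable_funM.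
  - by move=> x _; rewrite lee_fin.
have -> : (\int[D]_x ((a + b * mu) - b * h x)%:E = a%:E)%E.
  under eq_integral do rewrite EFinB EFinM.
  rewrite integralB//=; last 2 first.
  - by apply: (@bounded_integrable _ _ _ D (cst (a + b * mu)) `|a + b * mu|).
  - exact: integrableZl.
  rewrite integralZl//.
  have -> : (\int[D]_x (a + b * mu)%:E = (a + b * mu)%:E)%E.
    by rewrite -[RHS](expectation_cst D) unlock.
  have -> : (\int[D]_x (h x)%:E = mu%:E)%E by rewrite -muE unlock.
  by rewrite -EFinM -EFinB addrK.
rewrite lee_fin (le_trans (cosh_le_expR_sqr (2 * s)))// ler_expR.
by rewrite le_eqVlt; apply/orP; left; apply/eqP; field.
Qed.

(** Chernoff's method: the exponential moment of the deviation [Z] factors over the sample, and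
    [mgf_le] bounds each factor. *)
Lemma hoeffding (R : realType) (d d' : measure_display)
    (Omega : measurableType d) (T : measurableType d')
    (P : probability Omega R) (D : probability T R) (m : nat)
    (X : 'I_m -> {mfun Omega >-> T}) (h : T -> R) (t : R) :
  iid P D X -> (0 < m)%N -> 0 < t ->
  measurable_fun [set: T] h -> (forall x, `|h x| <= 1) ->
  (P [set w | t <= fine 'E_D[h] - m%:R^-1 * \sum_(j < m) h (X j w)]%R <=
   (expR (- (m%:R * t ^+ 2 / 8)))%:E)%E.
Proof.
move=> hX m0 t0 mh h1; set mu := fine _.
have mR0 : 0 < m%:R :> R by rewrite ltr0n.
pose Z w := mu - m%:R^-1 * \sum_(j < m) h (X j w).
have mhX j : measurable_fun [set: Omega] (fun w => h (X j w)).
  exact: measurableT_comp.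
have mZ : measurable_fun [set: Omega] Z.
  apply: measurable_funB => //; apply: measurable_funM => //.
  exact: measurable_sum.
pose ZM := isMeasurableFun.Build _ _ _ _ Z mZ.
pose Z' : {RV P >-> R} := HB.pack Z ZM.
(* This Chernoff parameter puts [s = t / 4] on each sample point, the minimizer of [2 s^2 - s t],
   with minimum [- t^2 / 8]. *)
have r0 : 0 < m%:R * t / 4 by rewrite divr_gt0// mulr_gt0.
apply: (le_trans (chernoff Z' t r0)).
rewrite /mmt_gen_fun unlock.
pose phi (_ : 'I_m) x := expR (t / 4 * (mu - h x)).
have mphi j : measurable_fun [set: T] (phi j).
  apply: measurableT_comp => //; apply: measurable_funM => //.
  exact: measurable_funB.
have phi_le j : (\int[D]_x (phi j x)%:E <= (expR (2 * (t / 4) ^+ 2))%:E)%E.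
  exact: mgf_le.
have phi_ge0 j : (0 <= \int[D]_x (phi j x)%:E)%E.
  by apply: integral_ge0 => x _; rewrite lee_fin expR_ge0.
have phifin j : (\int[D]_x (phi j x)%:E)%E \is a fin_num.
  by rewrite ge0_fin_numE// (le_lt_trans (phi_le j)) ?ltry.
have -> : (\int[P]_w ((expR \o (m%:R * t / 4) \o* Z') w)%:E =
           \prod_j \int[D]_x (phi j x)%:E)%E.
  rewrite -(iid_integral_prod hX mphi _ phifin); last first.
    by move=> *; exact: expR_ge0.
  apply: eq_integral => w _; congr (_%:E) => /=.
  rewrite -expR_sum; congr expR.
  rewrite -mulr_sumr sumrB sumr_const card_ord -mulr_natr /Z.
  by field; rewrite gt_eqF.
apply: (@le_trans _ _ ((expR (2 * (t / 4) ^+ 2) ^+ m)%:E *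
    (expR (- (m%:R * t / 4 * t)))%:E)%E).
  rewrite lee_wpmul2r ?lee_fin ?expR_ge0//.
  under eq_bigr => j _ do rewrite -(fineK (phifin j)).
  rewrite prodEFin lee_fin -[in leRHS](card_ord m) -prodr_const.
  by apply: ler_prod => j _; rewrite fine_ge0//= -lee_fin fineK.
rewrite -EFinM lee_fin -expRM_natl -expRD ler_expR.
by rewrite le_eqVlt; apply/orP; left; apply/eqP; field.
Qed.

(** * Suprema of finite families *)

Lemma sup_range_ge (R : realType) (I : finType) (h : I -> R) (i : I) :
  h i <= sup (range h).
Proof.
apply: ub_le_sup; last by exists i.
exists (\sum_j `|h j|) => _ [j _ <-].
rewrite (bigD1 j)//= (le_trans (ler_norm _))// lerDl.
by apply: sumr_ge0.
Qed.

(** The point [i0] excludes the empty range, whose [sup] is 0 by default and could exceed [M]. *)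
Lemma sup_range_le (R : realType) (I : Type) (i0 : I) (h : I -> R) (M : R) :
  (forall i, h i <= M) -> sup (range h) <= M.
Proof.
by move=> hM; apply: ge_sup; [exists (h i0), i0|move=> _ [i _ <-]].
Qed.

Lemma ler_dist_sup_range (R : realType) (I : finType) (i0 : I) (h g : I -> R)
    (e : R) :
  (forall i, `|h i - g i| <= e) -> `|sup (range h) - sup (range g)| <= e.
Proof.
move=> hg; rewrite ler_distl; apply/andP; split.
- rewrite lerBlDr; apply: (sup_range_le i0) => i.
  have := hg i; rewrite ler_distl => /andP[+ _].
  by rewrite lerBlDr => /le_trans; apply; rewrite lerD2r sup_range_ge.
- apply: (sup_range_le i0) => i.
  have := hg i; rewrite ler_distl => /andP[_].
  by move=> /le_trans; apply; rewrite lerD2r sup_range_ge.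
Qed.

Lemma measurable_sup_range (R : realType) (d : measure_display)
    (T : measurableType d) (I : finType) (i0 : I) (h : I -> T -> R) :
  (forall i, measurable_fun [set: T] (h i)) ->
  measurable_fun [set: T] (fun x => sup (range (fun i => h i x))).
Proof.
move=> mh.
(* The supremum becomes an iterated maximum. Its initial value [h i0 x] lies in the range and so
   does not alter it. *)
rewrite (_ : (fun x => _) = fun x => \big[Num.max/h i0 x]_i h i x); last first.
  apply/funext => x; apply/eqP; rewrite eq_le; apply/andP; split.
    by apply: (sup_range_le i0) => i; exact: le_bigmax.
  apply: bigmax_le => [|i _].
    exact: (sup_range_ge (fun i => h i x) i0).
  exact: (sup_range_ge (fun i => h i x) i).
elim: (index_enum I) => [|i s IH].
  by under eq_fun do rewrite big_nil; exact: mh.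
by under eq_fun do rewrite big_cons; exact: measurable_maxr.
Qed.

(** * Product distributions and their distance *)

Lemma sum_profile_prod (R : realType) (n : nat) (k : 'I_n -> nat)
    (w : forall i : 'I_n, 'I_(k i) -> R) :
  \sum_(a : profile k) \prod_i w i (a i) = \prod_i \sum_b w i b.
Proof.
pose P i : {ffun 'I_(k i) -> R} := [ffun b => w i b].
(* The action sets depend on the player, while distributivity is applied to functions into a single
   type; [fprod] leads to tagged values. *)
transitivity (\sum_(t : fprod (fun i => 'I_(k i))) \prod_(i in 'I_n) P i (t i)).
  rewrite (reindex (@dffun_of_fprod _ (fun i => 'I_(k i)))); last first.
    exact/onW_bij/dffun_of_fprod_bij.
  by apply: eq_bigr => t _; apply: eq_bigr => i _; rewrite /P !ffunE.
rewrite big_fprod.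
rewrite -(bigA_distr_big_dep (fun i => tagged_with _ i)
  (fun i x => untag 0 (P i) x)).
apply: eq_bigr => i _; rewrite -(big_tag (fun i x => P i x)).
by apply: eq_bigr => b _; rewrite ffunE.
Qed.

Lemma prod_strategy_dist (R : realType) (n : nat) (k : 'I_n -> nat)
    (s t : forall i : 'I_n, simplex R 'I_(k i)) :
  \sum_(a : profile k) `|\prod_i s i (a i) - \prod_i t i (a i)| <=
  \sum_i \sum_b `|s i b - t i b|.
Proof.
(* Hybrid argument: the first [l] players follow [s], the others [t]. *)
pose H (l : nat) (a : profile k) :=
  \prod_(i < n) (if (i < l)%N then s i (a i) else t i (a i)).
(* Consecutive hybrids differ only at player [l], so the absolute value of their difference is again
   a product, with factors [w l i]. *)
pose w (l i : 'I_n) (b : 'I_(k i)) : R :=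
  if i == l then `|s i b - t i b| else if (i < l)%N then s i b else t i b.
have HS (l : 'I_n) a : `|H l.+1 a - H l a| = \prod_i w l i (a i).
  rewrite /H [X in `|X - _|](bigD1 l)//= [X in `|_ - X|](bigD1 l)//=.
  rewrite ltnSn ltnn [RHS](bigD1 l)//= {1}/w eqxx.
  rewrite (eq_bigr (fun i => w l i (a i))); last first.
    move=> i il; rewrite /w (negbTE il) ltnS leq_eqVlt.
    by rewrite (negbTE il : (_ == _ :> nat) = _).
  rewrite [X in `|_ - _ * X|](eq_bigr (fun i => w l i (a i))); last first.
    by move=> i il; rewrite /w (negbTE il).
  rewrite -mulrBl normrM; congr (_ * _); apply/ger0_norm/prodr_ge0 => i il.
  by rewrite /w (negbTE il); case: ifP => _; exact: mass_ge0.
have tele (a : profile k) : \prod_i s i (a i) - \prod_i t i (a i) =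
    \sum_(l < n) (H l.+1 a - H l a).
  rewrite -(big_mkord predT (fun l => H l.+1 a - H l a)) telescope_sumr//.
  by congr (_ - _); apply: eq_bigr => i _; rewrite ?ltn_ord.
apply: (@le_trans _ _ (\sum_(a : profile k) \sum_(l < n) \prod_i w l i (a i))).
  apply: ler_sum => a _; rewrite tele (le_trans (ler_norm_sum _ _ _))//.
  by apply: ler_sum => l _; rewrite HS.
(* Summed over all profiles, every factor other than that of [l] is a total mass 1. *)
rewrite exchange_big/=; apply: ler_sum => l _.
rewrite sum_profile_prod (bigD1 l)//= [X in _ * X]big1 => [|i il].
  by rewrite mulr1 /w eqxx.
by rewrite /w (negbTE il); case: (i < l)%N; exact: mass_sum1.
Qed.

(** * Lipschitz bound, range and measurability of the maximal gain *)

Section deviation_gain.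
Variables (R : realType) (n : nat) (k : 'I_n -> nat) (i0 : 'I_n).
Variables (B : 'I_n -> finType) (dev : forall i, B i -> profile k -> profile k).
Variable b0 : forall i, B i.
Local Notation U := (payoff R k).

(* Common form of the three equilibrium gaps: [B i] indexes the deviations
   available to player [i]. *)
Definition max_gain (p : profile k -> R) (u : U) : R :=
  sup (range (fun i => sup (range (fun b : B i =>
    \sum_a p a * u i (dev b a))) - utility p u i)).

Lemma pay_ge0 (u : U) i a : 0 <= u i a.
Proof. by case/andP: (pay_itv u i a). Qed.

Lemma pay_le1 (u : U) i a : u i a <= 1.
Proof. by case/andP: (pay_itv u i a). Qed.

Lemma ler_dist_payoff_sum (p q : profile k -> R) (u : U) i
    (g : profile k -> profile k) :
  `|\sum_a p a * u i (g a) - \sum_a q a * u i (g a)| <= \sum_a `|p a - q a|.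
Proof.
rewrite -sumrB (le_trans (ler_norm_sum _ _ _))//.
apply: ler_sum => a _; rewrite -mulrBl normrM ler_piMr//.
by rewrite ger0_norm ?pay_ge0// pay_le1.
Qed.

(** The factor 2 counts the deviation payoff and the utility. Each moves by at most the l1 distance
    because payoffs lie in [0, 1], and finite suprema preserve such a bound. *)
Lemma ler_dist_max_gain (p q : profile k -> R) (u : U) :
  `|max_gain p u - max_gain q u| <= 2 * \sum_a `|p a - q a|.
Proof.
apply: (ler_dist_sup_range i0) => i.
have tri (x y z t : R) : `|x - y - (z - t)| <= `|x - z| + `|y - t|.
  by rewrite (_ : x - y - (z - t) = (x - z) - (y - t)) ?ler_normB//; ring.
rewrite (le_trans (tri _ _ _ _))// mulr_natl mulr2n lerD//.
  by apply: (ler_dist_sup_range (b0 i)) => b; exact: ler_dist_payoff_sum.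
exact: (ler_dist_payoff_sum p q u i id).
Qed.

(* For a correlated [p] the gain can be negative, hence the range [-1, 1]. *)
Lemma max_gain_norm_le1 (p : profile k -> R) (u : U) :
  (forall a, 0 <= p a) -> \sum_a p a = 1 -> `|max_gain p u| <= 1.
Proof.
move=> p0 p1.
have avg i (g : profile k -> profile k) : 0 <= \sum_a p a * u i (g a) <= 1.
  rewrite sumr_ge0/= => [|a _]; last by rewrite mulr_ge0// pay_ge0.
  by rewrite -p1; apply: ler_sum => a _; rewrite ler_piMr// pay_le1.
have gain i : -1 <= sup (range (fun b : B i =>
    \sum_a p a * u i (dev b a))) - utility p u i <= 1.
  have /andP[u0 u1] := avg i id.
  have s1 : sup (range (fun b : B i => \sum_a p a * u i (dev b a))) <= 1.
    by apply: (sup_range_le (b0 i)) => b; case/andP: (avg i (dev b)).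
  have s0 : 0 <= sup (range (fun b : B i => \sum_a p a * u i (dev b a))).
    apply: le_trans (sup_range_ge _ (b0 i)).
    by case/andP: (avg i (dev (b0 i))).
  by apply/andP; rewrite /utility; split; lra.
rewrite ler_norml; apply/andP; split.
  apply: le_trans (sup_range_ge _ i0).
  by case/andP: (gain i0).
by apply: (sup_range_le i0) => i; case/andP: (gain i).
Qed.

Lemma measurable_pay i a : measurable_fun [set: U] (fun u : U => u i a).
Proof.
move=> _ A mA; rewrite setTI; apply: sub_sigma_algebra.
by exists i, a, A.
Qed.

Lemma measurable_max_gain (p : U -> profile k -> R) :
  (forall a, measurable_fun [set: U] (fun u => p u a)) ->
  measurable_fun [set: U] (fun u => max_gain (p u) u).
Proof.
move=> mp; apply: (measurable_sup_range i0) => i.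
apply: measurable_funB.
  apply: (measurable_sup_range (b0 i)) => b.
  apply: measurable_sum => a; apply: measurable_funM => //.
  exact: measurable_pay.
apply: measurable_sum => a; apply: measurable_funM => //.
  exact: measurable_pay.
Qed.

End deviation_gain.

(** * The gaps of NE, CE and CCE as maximal gains *)

Section equilibrium_gap.
Variables (R : realType) (n : nat) (k : 'I_n -> nat).
Hypothesis (hn : (0 < n)%N) (hk : forall i, (0 < k i)%N).
Variable c : concept.
Local Notation U := (payoff R k).

Let i0 : 'I_n := Ordinal hn.
Let b0 i : 'I_(k i) := Ordinal (hk i).

(** Gives the three concepts one common form. The third witness records that every player has a
    deviation, so that the suprema are over nonempty ranges. *)
Lemma equilibrium_gapE : exists (B : 'I_n -> finType)
    (dev : forall i, B i -> profile k -> profile k) (_ : forall i, B i),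
  forall (s : strategy R k c) (u : U),
    equilibrium_gap s u = max_gain dev (joint_mass s) u.
Proof.
case: c.
- by exists (fun i => 'I_(k i)), (fun i b a => deviate a b), b0.
- exists (fun i => {ffun 'I_(k i) -> 'I_(k i)}),
    (fun i (phi : {ffun 'I_(k i) -> 'I_(k i)}) (a : profile k) =>
      deviate a (phi (a i))),
    (fun i => [ffun=> b0 i]).
  by [].
- by exists (fun i => 'I_(k i)), (fun i b a => deviate a b), b0.
Qed.

Lemma joint_mass_ge0 (s : strategy R k c) a : 0 <= joint_mass s a.
Proof.
move: s; case: c => s /=; rewrite ?mass_ge0//.
by apply: prodr_ge0 => i _; exact: mass_ge0.
Qed.

Lemma joint_mass_sum1 (s : strategy R k c) : \sum_a joint_mass s a = 1.
Proof.
move: s; case: c => s /=; rewrite ?mass_sum1//.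
rewrite (sum_profile_prod (fun i => mass (s i))) big1// => i _.
exact: mass_sum1.
Qed.

Lemma measurable_joint_mass (f : approximator R k c) a :
  measurable_fun [set: U] (fun u => joint_mass (f u) a).
Proof.
by case: c f => -[f mf]//=; apply: measurable_prod => i _; exact: mf.
Qed.

(** Origin of [lip_const]: for NE the sum over players of the individual distances is at most [n]
    times their maximum, while for joint strategies both sides coincide. *)
Lemma joint_mass_dist (s t : strategy R k c) :
  2 * \sum_a `|joint_mass s a - joint_mass t a| <=
  lip_const R n c * strategy_dist s t.
Proof.
move: s t; case: c => //= s t; rewrite -mulrA ler_pM2l//.
apply: (le_trans (prod_strategy_dist s t)).
rewrite mulr_natl -[X in _ *+ X]card_ord -sumr_const; apply: ler_sum => i _.
exact: (sup_range_ge (fun i => \sum_b `|s i b - t i b|)).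
Qed.

Lemma equilibrium_gap_norm_le1 (s : strategy R k c) (u : U) :
  `|equilibrium_gap s u| <= 1.
Proof.
have [B [dev [d0 ->]]] := equilibrium_gapE.
apply: max_gain_norm_le1 => //; [exact: joint_mass_ge0|exact: joint_mass_sum1].
Qed.

Lemma equilibrium_gap_dist (s t : strategy R k c) (u : U) :
  `|equilibrium_gap s u - equilibrium_gap t u| <=
  lip_const R n c * strategy_dist s t.
Proof.
have [B [dev [d0 E]]] := equilibrium_gapE; rewrite !E.
exact: le_trans (ler_dist_max_gain i0 dev d0 _ _ _) (joint_mass_dist s t).
Qed.

Lemma measurable_equilibrium_gap (f : approximator R k c) :
  measurable_fun [set: U] (fun u => equilibrium_gap (f u) u).
Proof.
have [B [dev [d0 E]]] := equilibrium_gapE.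
under eq_fun do rewrite E.
by apply: measurable_max_gain => // a; exact: measurable_joint_mass.
Qed.

Lemma simplex_dist_le2 (T : finType) (p q : simplex R T) :
  \sum_x `|p x - q x| <= 2.
Proof.
apply: (@le_trans _ _ (\sum_x (p x + q x))).
  apply: ler_sum => x _; rewrite (le_trans (ler_normB _ _))//.
  by rewrite !ger0_norm// mass_ge0.
by rewrite big_split/= !mass_sum1.
Qed.

(** Distances between strategies are at most 2, so [linf_dist] is the supremum of a bounded set and
    not a default value. *)
Lemma strategy_dist_le_linf (f g : approximator R k c) u :
  strategy_dist (f u) (g u) <= linf_dist f g.
Proof.
apply: ub_le_sup; last by exists u.
exists 2 => _ [v _ <-]; move: (f v) (g v); case: c => s t /=.
- by apply: (sup_range_le i0) => i; exact: simplex_dist_le2.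
- exact: simplex_dist_le2.
- exact: simplex_dist_le2.
Qed.

Lemma lip_const_ge0 : 0 <= lip_const R n c.
Proof. by case: c => /=; rewrite ?mulr_ge0. Qed.

Lemma equilibrium_gap_linf (f g : approximator R k c) r u :
  linf_dist f g <= r ->
  `|equilibrium_gap (f u) u - equilibrium_gap (g u) u| <= lip_const R n c * r.
Proof.
move=> fgr; apply: (le_trans (equilibrium_gap_dist _ _ _)).
rewrite ler_wpM2l ?lip_const_ge0//.
exact: le_trans (strategy_dist_le_linf f g u) fgr.
Qed.

End equilibrium_gap.

(** * Comparison of expectations, finite covers and the union bound *)

Lemma expectation_le_dist (R : realType) (d : measure_display)
    (T : measurableType d) (D : probability T R) (f g : T -> R) (e : R) :
  measurable_fun [set: T] f -> (forall x, `|f x| <= 1) ->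
  measurable_fun [set: T] g -> (forall x, `|g x| <= 1) ->
  (forall x, `|f x - g x| <= e) ->
  fine ('E_D[f])%E <= fine ('E_D[g])%E + e.
Proof.
move=> mf f1 mg g1 fg.
have If := bounded_integrable D mf f1.
have Ig := bounded_integrable D mg g1.
have Ie : D.-integrable [set: T] (EFin \o cst e).
  by apply: (@bounded_integrable _ _ _ D (cst e) `|e|).
have fin h : D.-integrable [set: T] (EFin \o h) -> ('E_D[h] \is a fin_num)%E.
  by move=> Ih; rewrite unlock; exact: integrable_fin_num.
rewrite -lee_fin EFinD !fineK ?fin// -[e%:E](expectation_cst D) unlock.
rewrite -integralD//; apply: le_integral => //; first exact: integrableD.
move=> x _ /=; rewrite -EFinD lee_fin -lerBlDl.
exact: le_trans (ler_norm _) (fg x).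
Qed.

(** A finite infimum is taken over a nonempty set of natural numbers, whose least element attains
    it. *)
Lemma covering_number_attained (R : realType) (n : nat) (k : 'I_n -> nat)
    (c : concept) (F : set (approximator R k c)) (r : R) :
  (covering_number F r < +oo)%E ->
  exists N : nat, covering_number F r = (N%:R)%:E /\
    exists2 G, (G #= `I_N)%card & covers r G F.
Proof.
rewrite /covering_number; set S := [set N | _ ] => fin.
have /ereal_inf_lt[_ [N0 SN0 _] _] := fin.
have exS : exists N, `[< S N >] by exists N0; apply/asboolP.
case: (ex_minnP exS) => N /asboolP SN Nmin; exists N; split => //.
apply/eqP; rewrite eq_le; apply/andP; split.
  by apply: ereal_inf_lbound; exists N.
apply/ereal_infP => _ [M SM <-].
by rewrite lee_fin ler_nat; apply: Nmin; apply/asboolP.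
Qed.

Lemma sqrtrD_le (R : rcfType) (x y : R) : 0 <= x -> 0 <= y ->
  Num.sqrt (x + y) <= Num.sqrt x + Num.sqrt y.
Proof.
move=> x0 y0; rewrite -(ler_pXn2r (ltn0Sn 1)) ?nnegrE ?addr_ge0 ?sqrtr_ge0//.
rewrite sqrrD !sqr_sqrtr ?addr_ge0// lerD2r lerDl.
by rewrite mulrn_wge0// mulr_ge0// sqrtr_ge0.
Qed.

(** Union bound: each of the [N] functions has a large deviation with probability at most
    [delta / N]. *)
Lemma finite_uniform_deviation (R : realType) (d d' : measure_display)
    (Omega : measurableType d) (T : measurableType d')
    (P : probability Omega R) (D : probability T R) (m N : nat)
    (X : 'I_m -> {mfun Omega >-> T}) (h : nat -> T -> R) (delta : R) :
  iid P D X -> (0 < m)%N -> (0 < N)%N -> 0 < delta < 1 ->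
  (forall j, measurable_fun [set: T] (h j)) -> (forall j x, `|h j x| <= 1) ->
  exists G : set Omega, [/\ measurable G, ((1 - delta)%:E <= P G)%E &
    forall w, G w -> forall j, (j < N)%N ->
      fine ('E_D[h j])%E - m%:R^-1 * \sum_(i < m) h j (X i w) <=
      2 * Num.sqrt (2 * ln N%:R / m%:R) +
      2 * Num.sqrt (2 * ln delta^-1 / m%:R)].
Proof.
move=> hX m0 N0 /andP[d0 d1] mh h1.
have mR0 : 0 < m%:R :> R by rewrite ltr0n.
have NR0 : 0 < N%:R :> R by rewrite ltr0n.
have NR1 : 1 <= N%:R :> R by rewrite ler1n.
have dV1 : 1 < delta^-1 by rewrite invf_gt1.
have lnN : 0 <= ln N%:R :> R by rewrite ln_ge0.
have lnd : 0 < ln delta^-1 by rewrite ln_gt0.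
(* Solution of [exp (- m t^2 / 8) = delta / N]; subadditivity of the square root then separates [N]
   from [delta]. *)
pose t := Num.sqrt (8 * (ln N%:R + ln delta^-1) / m%:R).
have t2 : t ^+ 2 = 8 * (ln N%:R + ln delta^-1) / m%:R.
  by rewrite sqr_sqrtr// divr_ge0 ?mulr_ge0 ?addr_ge0// ltW.
have t0 : 0 < t.
  by rewrite sqrtr_gt0 divr_gt0// mulr_gt0// ltr_wpDl.
have t_le : t <= 2 * Num.sqrt (2 * ln N%:R / m%:R) +
    2 * Num.sqrt (2 * ln delta^-1 / m%:R).
  have -> : t =
      Num.sqrt (2 ^+ 2 * (2 * ln N%:R / m%:R + 2 * ln delta^-1 / m%:R)).
    by congr Num.sqrt; field; rewrite gt_eqF.
  rewrite sqrtrM ?sqr_ge0// sqrtr_sqr ger0_norm// -mulrDr ler_pM2l//.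
  by apply: sqrtrD_le; rewrite divr_ge0 ?mulr_ge0// ltW.
pose bad j := [set w |
  t <= fine ('E_D[h j])%E - m%:R^-1 * \sum_(i < m) h j (X i w)].
have mbad j : measurable (bad j).
  rewrite -[bad j]setTI.
  have -> : bad j = (fun w => fine ('E_D[h j])%E -
      m%:R^-1 * \sum_(i < m) h j (X i w)) @^-1` `[t, +oo[%classic.
    by apply/seteqP; split => w /=; rewrite in_itv/= andbT.
  have mf : measurable_fun [set: Omega] (fun w => fine ('E_D[h j])%E -
      m%:R^-1 * \sum_(i < m) h j (X i w)).
    apply: measurable_funB => //; apply: measurable_funM => //.
    by apply: measurable_sum => i; exact: measurableT_comp.
  by apply: mf.
have Pbad j : (P (bad j) <= (delta / N%:R)%:E)%E.
  apply: (le_trans (hoeffding hX m0 t0 (mh j) (h1 j))).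
  rewrite lee_fin t2.
  have -> : - (m%:R * (8 * (ln N%:R + ln delta^-1) / m%:R) / 8) =
      - (ln N%:R + ln delta^-1) :> R.
    by field; rewrite gt_eqF.
  rewrite opprD expRD expRN lnK ?posrE// expRN lnK ?posrE ?invr_gt0// invrK.
  by rewrite mulrC.
pose B := \big[setU/set0]_(j < N) bad j.
have mB : measurable B by exact: bigsetU_measurable.
exists (~` B); split; first exact: measurableC.
  rewrite probability_setC// EFinB leeB//.
  apply: (le_trans (Boole_inequality _ _)) => //.
  apply: (@le_trans _ _ (\sum_(j < N) (delta / N%:R)%:E)%E).
    by apply: lee_sum => j _; exact: Pbad.
  rewrite sumEFin lee_fin sumr_const card_ord -[X in X <= _]mulr_natr divfK//.
  by rewrite gt_eqF.
move=> w Bw j jN; apply: le_trans t_le.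
rewrite leNgt; apply/negP => tj; apply: Bw.
rewrite /B -bigcup_mkord; exists j => //.
exact: ltW.
Qed.

(** * From a finite cover to the whole class *)

Theorem theorem4p3 (R : realType) (n : nat) (k : 'I_n -> nat)
    (hn : (2 <= n)%N) (hk : forall i, (0 < k i)%N)
    (c : concept) (F : set (approximator R k c))
    (D : probability (payoff R k) R)
    (m : nat) (hm : (1 <= m)%N) (delta : R) (hdelta : 0 < delta < 1)
    (d : measure_display) (Omega : measurableType d) (P : probability Omega R)
    (X : 'I_m -> {mfun Omega >-> payoff R k}) (hX : iid P D X) :
  exists G : set Omega, [/\ measurable G,
    ((1 - delta)%:E <= P G)%E &
    forall w, G w -> forall f : approximator R k c, F f ->
      ('E_D[(fun u : payoff R k => equilibrium_gap (f u) u)]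
       - (m%:R^-1 * \sum_(j < m) equilibrium_gap (f (X j w)) (X j w))%:E
       <= 2%:E * ereal_inf
              [set sqrte (2%:E * lne (covering_number F r) * (m%:R^-1)%:E)
                   + (lip_const R n c * r)%:E | r in [set r : R | (0 < r)%R]]
          + (4 * Num.sqrt (2 * ln (4 / delta) / m%:R))%:E)%E].
Proof.
have n0 : (0 < n)%N by exact: ltnW.
have /andP[d0 d1] := hdelta.
have mR0 : 0 < m%:R :> R by rewrite ltr0n.
have trivial_event (Q : Omega -> Prop) : (forall w, Q w) ->
    exists G : set Omega, [/\ measurable G, ((1 - delta)%:E <= P G)%E &
      forall w, G w -> Q w].
  move=> HQ; exists setT; split=> //.
  by rewrite probability_setT lee_fin lerBlDr lerDl ltW.
(* The empty class has covering number 0 and is set apart; a member [f0] forces every cover to be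
   nonempty. *)
have [F0|/set0P[f0 Ff0]] := eqVneq F set0.
  by apply: trivial_event => w f; rewrite F0.
set S := [set _ | _ in _]; set I := ereal_inf S.
have [Ioo|Ioo] := eqVneq I +oo%E.
  apply: trivial_event => w f _.
  by rewrite Ioo mulry gtr0_sg// mul1e addye ?leey.
have I0 : (0 <= I)%E.
  apply/ereal_infP => _ [r /= r0 <-].
  by rewrite adde_ge0 ?sqrte_ge0// lee_fin mulr_ge0 ?lip_const_ge0// ltW.
have Ifin : I \is a fin_num by rewrite ge0_fin_numE// lt_neqAle Ioo leey.
set e := Num.sqrt (2 * ln (4 / delta) / m%:R).
have dV1 : 1 < delta^-1 by rewrite invf_gt1.
have d4 : delta^-1 <= 4 / delta by rewrite ler_peMl ?invr_ge0 ?ltW//; lra.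
have e0 : 0 < e.
  by rewrite sqrtr_gt0 divr_gt0// mulr_gt0// ln_gt0// (lt_le_trans dV1).
(* The positive slack [e] provides an [r] whose bracket lies below [I + e]. *)
have : (I < (fine I + e)%:E)%E by rewrite -{1}(fineK Ifin) lte_fin ltrDl.
move=> /ereal_inf_lt[_ [r /= r0 <-]] rI.
have : (covering_number F r < +oo)%E.
  rewrite lt_neqAle leey andbT; apply/eqP => Noo; move: rI.
  by rewrite Noo /= mulry gtr0_sg// mul1e mulyr gtr0_sg ?invr_gt0// mul1e.
move=> /covering_number_attained[N [NE [G0 G0N G0F]]].
have [g0 G0g0 _] := G0F _ Ff0.
have G0n : G0 != set0 by apply/set0P; exists g0.
have [g [_ _]] := finite_set_bij G0n G0N (@subset_refl _ G0).
have gsurj g' : G0 g' -> exists2 j, (j < N)%N & g j = g'.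
  by move=> /(@surj _ _ _ _ g).
(* Positivity of [N] makes [lne] the real logarithm instead of its value [-oo] at 0. *)
have N0 : (0 < N)%N by have [j jN _] := gsurj _ G0g0; exact: leq_trans jN.
move: rI; rewrite NE lne_EFin ?ltr0n// -!EFinM /= -EFinD lte_fin => rI.
pose h j u := equilibrium_gap (g j u) u.
(* The event depends on the cover alone and is fixed before [f], whence the uniformity over [F]. *)
have [G [mG PG HG]] := finite_uniform_deviation hX hm N0 hdelta
  (fun j => measurable_equilibrium_gap n0 hk (g j))
  (fun j u => equilibrium_gap_norm_le1 n0 hk (g j u) u).
exists G; split => // w Gw f Ff.
have [g' G0g' fg'] := G0F _ Ff.
have [j jN gj] := gsurj _ G0g'.
have dist u := equilibrium_gap_linf n0 hk u fg'.
have Efin : ('E_D[fun u => equilibrium_gap (f u) u] \is a fin_num)%E.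
  rewrite unlock; apply: integrable_fin_num => //.
  apply: bounded_integrable (measurable_equilibrium_gap n0 hk f) _ => u.
  exact: equilibrium_gap_norm_le1.
rewrite -(fineK Efin) -(fineK Ifin) -EFinB -EFinM -EFinD lee_fin.
have := HG w Gw j jN; rewrite gj => Hj.
have HE := expectation_le_dist D (measurable_equilibrium_gap n0 hk f)
  (fun u => equilibrium_gap_norm_le1 n0 hk (f u) u)
  (measurable_equilibrium_gap n0 hk g')
  (fun u => equilibrium_gap_norm_le1 n0 hk (g' u) u) dist.
have Hemp : m%:R^-1 * \sum_(i < m) equilibrium_gap (g' (X i w)) (X i w) <=
    m%:R^-1 * \sum_(i < m) equilibrium_gap (f (X i w)) (X i w) +
    lip_const R n c * r.
  have -> : lip_const R n c * r = m%:R^-1 * \sum_(i < m) (lip_const R n c * r).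
    by rewrite sumr_const card_ord -[X in _ = _ * X]mulr_natl mulKf// gt_eqF.
  rewrite -mulrDr ler_pM2l ?invr_gt0// -big_split/=; apply: ler_sum => i _.
  rewrite -lerBlDl (le_trans (ler_norm _))// distrC; exact: dist.
have Hd : Num.sqrt (2 * ln delta^-1 / m%:R) <= e.
  rewrite ler_wsqrtr// ler_pM2r ?invr_gt0// ler_pM2l//.
  rewrite ler_ln ?posrE ?invr_gt0//.
  by rewrite divr_gt0.
(* [L] enters twice, through the expectation and the empirical mean. Doubling [rI] costs [2 e] and
   the confidence term at most [2 e], in total [4 e]. *)
move: rI Hj HE Hemp Hd; set A := Num.sqrt _; set B := Num.sqrt _.
set L := lip_const R n c * r.
lra.
Qed.
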